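(* Let $\mathbb{F}$ be a field, let $X$ be a Jacobi--Jordan algebra over $\mathbb{F}$ and let $U\colon\mathbf{JJord}\to\mathbf{PAlg}$ denote the forgetful functor to the category of partial algebras. (1) There exists a natural isomorphism of functors $\mathbf{JJord}^{\mathrm{op}}\to\mathbf{Set}$ $$\rho\colon\mathrm{SplExt}(-,X)\cong\mathrm{Hom}_{\mathbf{PAlg}}(U(-),\mathrm{ADer}(X)),$$ where $\mathrm{SplExt}(-,X)=\mathrm{SplExt}_{\mathbf{JJord}}(-,X)$. (2) If $\mathrm{ADer}(X)$ is a Jacobi--Jordan algebra, then the functor $\mathrm{SplExt}(-,X)$ is representable and $\mathrm{ADer}(X)$ is the actor of $X$.
   Context: $\mathbf{JJord}$ is the variety of Jacobi--Jordan algebras: $\mathbb{F}$-vector spaces with a bilinear multiplication satisfying $xy=yx$ and $x(yz)+y(zx)+z(xy)=0$; morphisms are multiplicative linear maps. A partial algebra $(Y,\cdot,\Omega)$ is a vector space $Y$ with a map $\cdot\colon\Omega\to Y$, $\Omega\subseteq Y\times Y$, where for each fixed $y$ the sets $\{x\mid(x,y)\in\Omega\}$ and $\{x\mid(y,x)\in\Omega\}$ are subspaces and $\cdot$ is linear in each variable on them. A homomorphism $(Y,\cdot,\Omega)\to(Y',\ast,\Omega')$ is a linear map $f$ such that $(x,y)\in\Omega$ implies $(f(x),f(y))\in\Omega'$ and $f(x\cdot y)=f(x)\ast f(y)$. $\mathbf{PAlg}$ is the category of partial algebras; an algebra is a partial algebra with $\Omega=Y\times Y$ (total). $\mathrm{ADer}(X)$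 is the vector space of anti-derivations of $X$, i.e. linear maps $d\colon X\to X$ with $d(xy)=-d(x)y-d(y)x$ for all $x,y\in X$. It is a partial algebra with operation $\langle f,f'\rangle=-f\circ f'-f'\circ f$, defined on $\Omega=\{(f,f')\in\mathrm{ADer}(X)^2\mid\langle f,f'\rangle\in\mathrm{ADer}(X)\}$. ''$\mathrm{ADer}(X)$ is a Jacobi--Jordan algebra'' means that this operation is total and makes $\mathrm{ADer}(X)$ an object of $\mathbf{JJord}$. A split extension of $B$ by $X$ is a diagram $X\xrightarrow{i}A\rightleftarrows B$ in $\mathbf{JJord}$ with $\pi\colon A\to B$, $s\colon B\to A$, $\pi s=1_B$, $i$ a kernel of $\pi$. $\mathrm{SplExt}(-,X)$ sends $B$ to the set of isomorphism classes (isomorphisms fixing $X$ and $B$) of split extensions of $B$ by $X$, and $f\colon B'\to B$ to pullback along $f$. An actor of $X$ is an object $[X]$ of the category with a natural isomorphism $\mathrm{SplExt}(-,X)\cong\mathrm{Hom}(-,[X])$. *)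

(* Defs.v *)
From HB Require Import structures.
From mathcomp Require Import all_boot all_algebra.
From mathcomp Require Import boolp classical_sets functions.

Set Implicit Arguments.
Unset Strict Implicit.
Unset Printing Implicit Defensive.

Import GRing.Theory.

Local Open Scope classical_set_scope.
Local Open Scope ring_scope.

Record category := Category {
  obj :> Type;
  hom : obj -> obj -> Type;
  idm : forall a, hom a a;
  compm : forall a b c, hom b c -> hom a b -> hom a c;
  compm1 : forall a b (f : hom a b), compm f (idm a) = f;
  comp1m : forall a b (f : hom a b), compm (idm b) f = f;
  compmA : forall a b c d (h : hom c d) (g : hom b c) (f : hom a b),
    compm h (compm g f) = compm (compm h g) f }.

Definition is_isom (C : category) (a b : C) (f : hom a b) : Prop :=
  exists g : hom b a, compm g f = idm a /\ compm f g = idm b.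

Definition op (C : category) : category :=
  @Category C (fun a b => hom b a) (fun a => idm a)
    (fun a b c g f => compm f g)
    (fun a b f => comp1m f) (fun a b f => compm1 f)
    (fun a b c d h g f => esym (compmA f g h)).

Definition Sets : category :=
  @Category Type (fun S T => S -> T) (fun S x => x) (fun R S T g f x => g (f x))
    (fun _ _ _ => erefl) (fun _ _ _ => erefl) (fun _ _ _ _ _ _ _ => erefl).

Record functor (C D : category) := Functor {
  fobj :> C -> D;
  fmap : forall a b, hom a b -> hom (fobj a) (fobj b);
  fmap1 : forall a, fmap (idm a) = idm (fobj a);
  fmapM : forall a b c (g : hom b c) (f : hom a b),
    fmap (compm g f) = compm (fmap g) (fmap f) }.

Definition op_functor (C D : category) (G : functor C D) :
    functor (op C) (op D) :=
  @Functor (op C) (op D) G (fun a b f => fmap G f)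
    (fun a => fmap1 G a) (fun a b c g f => fmapM G f g).

Lemma comp_functor1 (C D E : category) (G : functor D E) (H : functor C D) a :
  fmap G (fmap H (idm a)) = idm (G (H a)).
Proof. by rewrite !fmap1. Qed.

Lemma comp_functorM (C D E : category) (G : functor D E) (H : functor C D)
    (a b c : C) (g : hom b c) (f : hom a b) :
  fmap G (fmap H (compm g f)) = compm (fmap G (fmap H g)) (fmap G (fmap H f)).
Proof. by rewrite !fmapM. Qed.

Definition comp_functor (C D E : category) (G : functor D E) (H : functor C D) :
    functor C E :=
  @Functor C E (fun a => G (H a)) (fun a b f => fmap G (fmap H f))
    (comp_functor1 G H) (comp_functorM G H).

Record nat_trans (C D : category) (G H : functor C D) := NatTrans {
  component :> forall a, hom (G a) (H a);
  naturality : forall a b (f : hom a b),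
    compm (component b) (fmap G f) = compm (fmap H f) (component a) }.

Definition is_natural_iso (C D : category) (G H : functor C D)
    (rho : nat_trans G H) : Prop :=
  forall a, is_isom (rho a).

Definition hom_to (C : category) (c : C) : functor (op C) Sets :=
  @Functor (op C) Sets (fun a : C => hom a c)
    (fun (a b : C) (f : hom b a) (g : hom a c) => compm g f)
    (fun a : C => funext (fun g : hom a c => compm1 g))
    (fun (a b d : C) (g : hom d b) (f : hom b a) =>
       funext (fun h : hom a c => compmA h f g)).

Definition represents (C : category) (G : functor (op C) Sets) (c : C) : Prop :=
  exists rho : nat_trans G (hom_to c), is_natural_iso rho.

Definition representable (C : category) (G : functor (op C) Sets) : Prop :=
  exists c : C, represents G c.

(* {vspace V} would only cover finite-dimensional V. *)

Section Subspace.
Variables (F : fieldType) (V : lmodType F).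

Definition subspace (S : set V) : Prop :=
  S 0 /\ forall a u v, S u -> S v -> S (a *: u + v).

Record subspace_of := Subspace {
  subspace_set :> V -> Prop;
  _ : subspace subspace_set }.

Variable S : subspace_of.

Definition sub_pred : {pred V} := fun x => `[< S x >].

Fact sub_pred_closed : submod_closed sub_pred.
Proof.
rewrite /sub_pred; case: S => T [T0 TD]; split=> [|a u v].
  exact/asboolP.
by move=> /asboolP Tu /asboolP Tv; apply/asboolP/TD.
Qed.

HB.instance Definition _ := GRing.isSubmodClosed.Build F V sub_pred sub_pred_closed.

Record sub_lmod := SubLmod { sub_val : V; sub_valP : sub_val \in sub_pred }.

HB.instance Definition _ := [isSub for sub_val].
HB.instance Definition _ := [Choice of sub_lmod by <:].
HB.instance Definition _ := [SubChoice_isSubLmodule of sub_lmod by <:].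

Definition mk_sub (x : V) (Sx : S x) : sub_lmod := SubLmod (introT (asboolP _) Sx).

Lemma sub_mem (x : sub_lmod) : S (val x).
Proof. exact/asboolP/(valP x). Qed.

End Subspace.

Record jjalg (F : fieldType) := JJAlg {
  jj_sort :> lmodType F;
  jjmul : jj_sort -> jj_sort -> jj_sort;
  jjmul_linl : forall y, linear (fun x => jjmul x y);
  jjmul_linr : forall x, linear (fun y => jjmul x y);
  jjmulC : forall x y, jjmul x y = jjmul y x;
  jj_jacobi : forall x y z,
    jjmul x (jjmul y z) + jjmul y (jjmul z x) + jjmul z (jjmul x y) = 0 }.

Declare Scope jj_scope.
Notation "x ∙ y" := (jjmul x y) (at level 40, left associativity) : jj_scope.
Local Open Scope jj_scope.

Lemma linear_ext (F : fieldType) (U V : lmodType F) (f g : {linear U -> V}) :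
  f =1 g -> f = g.
Proof.
case: f g => f [[fa] [fl]] [g [[ga] [gl]]] /= /funext eq_fg.
case: _ / eq_fg ga gl => ga gl.
by rewrite (Prop_irrelevance fa ga) (Prop_irrelevance fl gl).
Qed.

Section JJHom.
Variable F : fieldType.

Record jjhom (A B : jjalg F) := JJHom {
  jjhom_fun :> {linear A -> B};
  jjhomM : forall x y : A, jjhom_fun (x ∙ y) = jjhom_fun x ∙ jjhom_fun y }.

Lemma jjhom_ext (A B : jjalg F) (f g : jjhom A B) : f =1 g -> f = g.
Proof.
case: f g => f fM [g gM] /= /linear_ext eq_fg.
by case: _ / eq_fg gM => gM; rewrite (Prop_irrelevance fM gM).
Qed.

Definition jjid (A : jjalg F) : jjhom A A :=
  @JJHom A A idfun (fun _ _ => erefl).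

Fact jjcompM (A B C : jjalg F) (g : jjhom B C) (f : jjhom A B) (x y : A) :
  (g \o f) (x ∙ y) = (g \o f) x ∙ (g \o f) y.
Proof. by rewrite /= !jjhomM. Qed.

Definition jjcomp (A B C : jjalg F) (g : jjhom B C) (f : jjhom A B) : jjhom A C :=
  @JJHom A C (g \o f) (jjcompM g f).

Fact jjcomp1 (A B : jjalg F) (f : jjhom A B) : jjcomp f (jjid A) = f.
Proof. exact: jjhom_ext. Qed.

Fact jj1comp (A B : jjalg F) (f : jjhom A B) : jjcomp (jjid B) f = f.
Proof. exact: jjhom_ext. Qed.

Fact jjcompA (A B C D : jjalg F) (h : jjhom C D) (g : jjhom B C) (f : jjhom A B) :
  jjcomp h (jjcomp g f) = jjcomp (jjcomp h g) f.
Proof. exact: jjhom_ext. Qed.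

End JJHom.

Definition JJord (F : fieldType) : category :=
  @Category (jjalg F) (@jjhom F) (@jjid F) (@jjcomp F)
    (@jjcomp1 F) (@jj1comp F) (@jjcompA F).

(* The multiplication takes a proof that the pair lies in the domain; pmul_l and
   pmul_r hold for all such proofs. *)
Record palg (F : fieldType) := PAlgebra {
  palg_sort :> lmodType F;
  pdom : palg_sort -> palg_sort -> Prop;
  pmul : forall x y, pdom x y -> palg_sort;
  pdom_l : forall y, subspace [set x | pdom x y];
  pdom_r : forall y, subspace [set x | pdom y x];
  pmul_l : forall a x x' y (h : pdom x y) (h' : pdom x' y)
    (k : pdom (a *: x + x') y), pmul k = a *: pmul h + pmul h';
  pmul_r : forall a x x' y (h : pdom y x) (h' : pdom y x')
    (k : pdom y (a *: x + x')), pmul k = a *: pmul h + pmul h' }.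

Section PAlgHom.
Variable F : fieldType.

Record palghom (Y Z : palg F) := PAlgHom {
  palghom_fun :> {linear Y -> Z};
  palghom_dom : forall x y, pdom x y -> pdom (palghom_fun x) (palghom_fun y);
  palghomM : forall x y (h : pdom x y),
    palghom_fun (pmul h) = pmul (palghom_dom h) }.

Lemma palghom_ext (Y Z : palg F) (f g : palghom Y Z) : f =1 g -> f = g.
Proof.
case: f g => f fd fM [g gd gM] /= /linear_ext eq_fg.
case: _ / eq_fg gd gM => gd gM.
case: _ / (Prop_irrelevance fd gd) gM => gM.
by rewrite (Prop_irrelevance fM gM).
Qed.

Definition paid (Y : palg F) : palghom Y Y :=
  @PAlgHom Y Y idfun (fun _ _ h => h) (fun _ _ _ => erefl).

Fact pacompM (Y Z W : palg F) (g : palghom Z W) (f : palghom Y Z)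
    (x y : Y) (h : pdom x y) :
  (g \o f) (pmul h) = pmul (palghom_dom g (palghom_dom f h)).
Proof. by rewrite /= !palghomM. Qed.

Definition pacomp (Y Z W : palg F) (g : palghom Z W) (f : palghom Y Z) :
    palghom Y W :=
  @PAlgHom Y W (g \o f) (fun _ _ h => palghom_dom g (palghom_dom f h))
    (pacompM g f).

Fact pacomp1 (Y Z : palg F) (f : palghom Y Z) : pacomp f (paid Y) = f.
Proof. exact: palghom_ext. Qed.

Fact pa1comp (Y Z : palg F) (f : palghom Y Z) : pacomp (paid Z) f = f.
Proof. exact: palghom_ext. Qed.

Fact pacompA (Y Z W T : palg F) (h : palghom W T) (g : palghom Z W)
    (f : palghom Y Z) :
  pacomp h (pacomp g f) = pacomp (pacomp h g) f.
Proof. exact: palghom_ext. Qed.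

End PAlgHom.

Definition PAlg (F : fieldType) : category :=
  @Category (palg F) (@palghom F) (@paid F) (@pacomp F)
    (@pacomp1 F) (@pa1comp F) (@pacompA F).

Section Forgetful.
Variable F : fieldType.

Definition palg_of_jj (A : jjalg F) : palg F :=
  @PAlgebra F A (fun _ _ => True) (fun x y _ => x ∙ y)
    (fun _ => conj I (fun _ _ _ _ _ => I)) (fun _ => conj I (fun _ _ _ _ _ => I))
    (fun a x x' y _ _ _ => jjmul_linl y a x x')
    (fun a x x' y _ _ _ => jjmul_linr y a x x').

Definition palghom_of_jj (A B : jjalg F) (f : jjhom A B) :
    palghom (palg_of_jj A) (palg_of_jj B) :=
  @PAlgHom F (palg_of_jj A) (palg_of_jj B) f (fun _ _ h => h)
    (fun x y _ => jjhomM f x y).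

Fact palghom_of_jj1 (A : jjalg F) : palghom_of_jj (jjid A) = paid (palg_of_jj A).
Proof. exact: palghom_ext. Qed.

Fact palghom_of_jjM (A B C : jjalg F) (g : jjhom B C) (f : jjhom A B) :
  palghom_of_jj (jjcomp g f) = pacomp (palghom_of_jj g) (palghom_of_jj f).
Proof. exact: palghom_ext. Qed.

Definition forgetful : functor (JJord F) (PAlg F) :=
  @Functor (JJord F) (PAlg F) palg_of_jj palghom_of_jj
    palghom_of_jj1 palghom_of_jjM.

End Forgetful.

Record is_jj (F : fieldType) (Y : palg F) : Prop := IsJJ {
  is_jj_total : forall x y : Y, pdom x y;
  is_jj_comm : forall x y : Y,
    pmul (is_jj_total x y) = pmul (is_jj_total y x);
  is_jj_jacobi : forall x y z : Y,
    pmul (is_jj_total x (pmul (is_jj_total y z)))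
    + pmul (is_jj_total y (pmul (is_jj_total z x)))
    + pmul (is_jj_total z (pmul (is_jj_total x y))) = 0 }.

Definition jj_of_palg (F : fieldType) (Y : palg F) (h : is_jj Y) : JJord F :=
  @JJAlg F Y (fun x y => pmul (is_jj_total h x y))
    (fun y a x x' => pmul_l _ _ _) (fun y a x x' => pmul_r _ _ _)
    (is_jj_comm h) (is_jj_jacobi h).

Section AntiDerivations.
Variables (F : fieldType) (X : jjalg F).

Definition antiderivation (d : X -> X) : Prop :=
  linear d /\ forall x y, d (x ∙ y) = - (d x ∙ y) - (d y ∙ x).

Fact antiderivation_subspace : subspace (antiderivation : set (X -> X)).
Proof.
split=> [|a d d' [dl dA] [dl' dA']]; split.
- by move=> b u v; rewrite /= -[LHS]/0 -[in RHS]/0 scaler0 addr0.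
- move=> x y; rewrite -[LHS]/0 -![0 _]/0.
  have j0 z : (0 : X) ∙ z = 0.
    have := jjmul_linl z (-1) 0 0.
    by rewrite /= scaler0 addr0 scaleN1r addNr.
  by rewrite !j0 oppr0 addr0.
- move=> b u v; rewrite -[LHS]/(a *: d _ + d' _) dl dl'.
  rewrite -[(a *: d + d') u]/(a *: d u + d' u) -[(a *: d + d') v]/(a *: d v + d' v).
  by rewrite !scalerDr !scalerA mulrC addrACA.
- move=> x y; rewrite -[LHS]/(a *: d _ + d' _) dA dA'.
  rewrite -[(a *: d + d') x]/(a *: d x + d' x) -[(a *: d + d') y]/(a *: d y + d' y).
  rewrite !jjmul_linl scalerBr scalerN !opprD.
  by rewrite addrACA.
Qed.

Definition ader : lmodType F := sub_lmod (Subspace antiderivation_subspace).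

Definition ader_bracket (f f' : X -> X) : X -> X := - (f \o f') - (f' \o f).

Definition ader_dom (f f' : ader) : Prop :=
  antiderivation (ader_bracket (val f) (val f')).

Definition ader_mul (f f' : ader) (h : ader_dom f f') : ader :=
  mk_sub (S := Subspace antiderivation_subspace) h.

Lemma ader_bracketC (f f' : X -> X) : ader_bracket f f' = ader_bracket f' f.
Proof. by rewrite /ader_bracket addrC. Qed.

Lemma ader_bracket_l (a : F) (f f' : X -> X) (g : ader) :
  ader_bracket (a *: f + f') (val g)
  = a *: ader_bracket f (val g) + ader_bracket f' (val g).
Proof.
have [gl _] := sub_mem g; apply/funext => x.
rewrite /ader_bracket.
rewrite -[LHS]/(- (a *: f (val g x) + f' (val g x)) - val g (a *: f x + f' x)) gl.
rewrite -[RHS]/(a *: (- f (val g x) - val g (f x)) + (- f' (val g x) - val g (f' x))).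
by rewrite scalerBr scalerN !opprD addrACA.
Qed.

Lemma ader_bracket_r (a : F) (f f' : X -> X) (g : ader) :
  ader_bracket (val g) (a *: f + f')
  = a *: ader_bracket (val g) f + ader_bracket (val g) f'.
Proof. by rewrite !(ader_bracketC (val g)) ader_bracket_l. Qed.

Fact ader_dom_l (g : ader) : subspace [set f : ader | ader_dom f g].
Proof.
have [A0 AD] := antiderivation_subspace.
split=> [|a f f' Hf Hf'] /=; rewrite /ader_dom.
  have := ader_bracket_l (-1) 0 0 g.
  by rewrite scaler0 addr0 scaleN1r addNr /= => ->.
by rewrite [val _]/(a *: val f + val f') ader_bracket_l; apply: AD.
Qed.

Fact ader_dom_r (g : ader) : subspace [set f : ader | ader_dom g f].
Proof.
have -> : [set f : ader | ader_dom g f] = [set f : ader | ader_dom f g].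
  by apply/funext => f; rewrite /= /ader_dom ader_bracketC.
exact: ader_dom_l.
Qed.

Fact ader_mul_l a f f' g (h : ader_dom f g) (h' : ader_dom f' g)
    (k : ader_dom (a *: f + f') g) :
  ader_mul k = a *: ader_mul h + ader_mul h'.
Proof. by apply: val_inj => /=; exact: ader_bracket_l. Qed.

Fact ader_mul_r a f f' g (h : ader_dom g f) (h' : ader_dom g f')
    (k : ader_dom g (a *: f + f')) :
  ader_mul k = a *: ader_mul h + ader_mul h'.
Proof. by apply: val_inj => /=; exact: ader_bracket_r. Qed.

Definition ADer : PAlg F :=
  @PAlgebra F ader ader_dom ader_mul ader_dom_l ader_dom_r ader_mul_l ader_mul_r.

End AntiDerivations.

Definition is_kernel (F : fieldType) (X A B : jjalg F) (i : jjhom X A)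
    (p : jjhom A B) : Prop :=
  (forall x, p (i x) = 0) /\
  forall (C : jjalg F) (g : jjhom C A), (forall c, p (g c) = 0) ->
    exists! h : jjhom C X, jjcomp i h = g.

(* Stated with jjalg rather than obj (JJord F), whose universe is too large for
   SplExt to take its values in Sets. *)
Record split_ext (F : fieldType) (B X : jjalg F) := SplitExt {
  se_mid : jjalg F;
  se_ker : jjhom X se_mid;
  se_proj : jjhom se_mid B;
  se_sect : jjhom B se_mid;
  se_projK : jjcomp se_proj se_sect = jjid B;
  se_kerP : is_kernel se_ker se_proj }.

Definition split_iso (F : fieldType) (B X : jjalg F) (E E' : split_ext B X) :
    Prop :=
  exists phi : jjhom (se_mid E) (se_mid E'), [/\ @is_isom (JJord F) _ _ phi,
    jjcomp phi (se_ker E) = se_ker E',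
    jjcomp (se_proj E') phi = se_proj E &
    jjcomp phi (se_sect E) = se_sect E'].

Lemma jj_isomP (F : fieldType) (A B : jjalg F) (f : jjhom A B) :
  @is_isom (JJord F) A B f <->
  exists g : jjhom B A, jjcomp g f = jjid A /\ jjcomp f g = jjid B.
Proof. by []. Qed.

Section SplitIso.
Variables (F : fieldType) (B X : jjalg F).
Implicit Types E : split_ext B X.

Lemma split_iso_refl E : split_iso E E.
Proof.
exists (jjid (se_mid E)); split; rewrite ?jj1comp ?jjcomp1 //.
by apply/jj_isomP; exists (jjid (se_mid E)); rewrite jj1comp.
Qed.

Lemma split_iso_sym E E' : split_iso E E' -> split_iso E' E.
Proof.
move=> [phi [/jj_isomP [psi [K1 K2]] Hi Hp Hs]]; exists psi; split.
- by apply/jj_isomP; exists phi.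
- by rewrite -Hi jjcompA K1 jj1comp.
- by rewrite -Hp -jjcompA K2 jjcomp1.
- by rewrite -Hs jjcompA K1 jj1comp.
Qed.

Lemma split_iso_trans E E' E'' :
  split_iso E E' -> split_iso E' E'' -> split_iso E E''.
Proof.
move=> [f [/jj_isomP [f' [K1 K2]] Hi Hp Hs]] [g [/jj_isomP [g' [L1 L2]] Ki Kp Ks]].
exists (jjcomp g f); split.
- apply/jj_isomP; exists (jjcomp f' g'); split.
    by rewrite -jjcompA (jjcompA g') L1 jj1comp.
  by rewrite -jjcompA (jjcompA f) K2 jj1comp.
- by rewrite -jjcompA Hi.
- by rewrite jjcompA Kp.
- by rewrite -jjcompA Hs.
Qed.

(* The quotient by split_iso: an element is the class, as a predicate, of some
   split extension. *)
Record splext := SplExtClass {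
  splext_set :> split_ext B X -> Prop;
  splextP : exists E, splext_set = split_iso E }.

Lemma splext_inj (c c' : splext) : splext_set c = splext_set c' -> c = c'.
Proof.
case: c c' => P HP [Q HQ] /= eqPQ; case: _ / eqPQ HQ => HQ.
by rewrite (Prop_irrelevance HP HQ).
Qed.

Definition splext_class E : splext :=
  @SplExtClass (split_iso E) (ex_intro _ E erefl).

End SplitIso.

Section FibreProduct.
Variables (F : fieldType) (A B B' : jjalg F) (p : jjhom A B) (f : jjhom B' B).

Definition fp_set : set (A * B')%type := [set z | p z.1 = f z.2].

Fact fp_subspace : subspace fp_set.
Proof.
split=> [|a u v Hu Hv]; first by rewrite /fp_set /= !linear0.
by rewrite /fp_set /= !linearP Hu Hv.
Qed.

Definition fp_sort : lmodType F := sub_lmod (Subspace fp_subspace).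

Fact fp_mul_mem (x y : fp_sort) :
  fp_set ((val x).1 ∙ (val y).1, (val x).2 ∙ (val y).2).
Proof.
have Hx : fp_set (val x) := sub_mem x; have Hy : fp_set (val y) := sub_mem y.
by rewrite /fp_set /= !jjhomM Hx Hy.
Qed.

Definition fp_mul (x y : fp_sort) : fp_sort :=
  mk_sub (S := Subspace fp_subspace) (fp_mul_mem x y).

Fact fp_mul_linl y : linear (fun x => fp_mul x y).
Proof. by move=> a u v; apply: val_inj; congr pair; exact: jjmul_linl. Qed.

Fact fp_mul_linr x : linear (fun y => fp_mul x y).
Proof. by move=> a u v; apply: val_inj; congr pair; exact: jjmul_linr. Qed.

Fact fp_mulC x y : fp_mul x y = fp_mul y x.
Proof. by apply: val_inj; congr pair; exact: jjmulC. Qed.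

Fact fp_jacobi x y z :
  fp_mul x (fp_mul y z) + fp_mul y (fp_mul z x) + fp_mul z (fp_mul x y) = 0.
Proof. by apply: val_inj; congr pair; exact: jj_jacobi. Qed.

Definition fibre_product : jjalg F :=
  @JJAlg F fp_sort fp_mul fp_mul_linl fp_mul_linr fp_mulC fp_jacobi.

Definition fp_fst_fun (z : fibre_product) : A := (val z).1.
Definition fp_snd_fun (z : fibre_product) : B' := (val z).2.

Fact fp_fst_linear : linear fp_fst_fun. Proof. by []. Qed.
Fact fp_snd_linear : linear fp_snd_fun. Proof. by []. Qed.

HB.instance Definition _ :=
  GRing.isLinear.Build F fibre_product A *:%R fp_fst_fun fp_fst_linear.
HB.instance Definition _ :=
  GRing.isLinear.Build F fibre_product B' *:%R fp_snd_fun fp_snd_linear.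

Definition fp_fst : jjhom fibre_product A :=
  @JJHom F fibre_product A fp_fst_fun (fun _ _ => erefl).
Definition fp_snd : jjhom fibre_product B' :=
  @JJHom F fibre_product B' fp_snd_fun (fun _ _ => erefl).

Lemma fp_comm : jjcomp p fp_fst = jjcomp f fp_snd.
Proof. by apply: jjhom_ext => z; exact: (sub_mem z). Qed.

Lemma fp_ext (C : jjalg F) (g h : jjhom C fibre_product) :
  jjcomp fp_fst g = jjcomp fp_fst h -> jjcomp fp_snd g = jjcomp fp_snd h -> g = h.
Proof.
move=> e1 e2; apply: jjhom_ext => c; apply: val_inj.
rewrite [LHS]surjective_pairing [RHS]surjective_pairing; congr pair.
  exact: (congr1 (fun k : jjhom C A => k c) e1).
exact: (congr1 (fun k : jjhom C B' => k c) e2).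
Qed.

Section Pair.
Variables (C : jjalg F) (g : jjhom C A) (h : jjhom C B').
Hypothesis gh : jjcomp p g = jjcomp f h.

Fact fp_pair_mem c : fp_set (g c, h c).
Proof. exact: (congr1 (fun k : jjhom C B => k c) gh). Qed.

Definition fp_pair_fun (c : C) : fibre_product :=
  mk_sub (S := Subspace fp_subspace) (fp_pair_mem c).

Fact fp_pair_linear : linear fp_pair_fun.
Proof. by move=> a u v; apply: val_inj; congr pair; exact: linearP. Qed.

HB.instance Definition _ := GRing.isLinear.Build F C fibre_product *:%R
  fp_pair_fun fp_pair_linear.

Fact fp_pairM x y : fp_pair_fun (x ∙ y) = fp_pair_fun x ∙ fp_pair_fun y.
Proof. by apply: val_inj; congr pair; exact: jjhomM. Qed.

Definition fp_pair : jjhom C fibre_product :=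
  @JJHom F C fibre_product fp_pair_fun fp_pairM.

Lemma fp_fst_pair : jjcomp fp_fst fp_pair = g.
Proof. exact: jjhom_ext. Qed.

Lemma fp_snd_pair : jjcomp fp_snd fp_pair = h.
Proof. exact: jjhom_ext. Qed.

End Pair.
End FibreProduct.

Fact jjzeroM (F : fieldType) (A B : jjalg F) (x y : A) :
  (\0 : {linear A -> B}) (x ∙ y)
  = (\0 : {linear A -> B}) x ∙ (\0 : {linear A -> B}) y.
Proof.
have := @jjmul_linl F B 0 (-1) 0 0.
by rewrite /= scaler0 addr0 scaleN1r addNr.
Qed.

Definition jjzero (F : fieldType) (A B : jjalg F) : jjhom A B :=
  @JJHom F A B \0 (@jjzeroM F A B).

Section PullbackExt.
Variables (F : fieldType) (X B B' : jjalg F) (f : jjhom B' B) (E : split_ext B X).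

Fact pb_ker_comm : jjcomp (se_proj E) (se_ker E) = jjcomp f (jjzero X B').
Proof.
apply: jjhom_ext => x /=; rewrite linear0.
by case: (se_kerP E) => ->.
Qed.

Fact pb_sect_comm : jjcomp (se_proj E) (jjcomp (se_sect E) f) = jjcomp f (jjid B').
Proof. by rewrite jjcompA [jjcomp (se_proj E) _](se_projK E) jj1comp jjcomp1. Qed.

Definition pb_ker : jjhom X (fibre_product (se_proj E) f) :=
  fp_pair pb_ker_comm.
Definition pb_proj : jjhom (fibre_product (se_proj E) f) B' :=
  fp_snd (se_proj E) f.
Definition pb_sect : jjhom B' (fibre_product (se_proj E) f) :=
  fp_pair pb_sect_comm.

Fact pb_projK : jjcomp pb_proj pb_sect = jjid B'.
Proof. exact: fp_snd_pair. Qed.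

Fact pb_kerP : is_kernel pb_ker pb_proj.
Proof.
split=> [x //|C g g0].
have [_ /(_ C (jjcomp (fp_fst _ _) g)) []] := se_kerP E.
  move=> c; have : se_proj E (val (g c)).1 = f (val (g c)).2 := sub_mem (g c).
  by move=> /= ->; rewrite [X in f X](g0 c) linear0.
move=> h [hE hU]; exists h; split=> [|h' h'E].
  apply: fp_ext.
    by rewrite -hE; apply: jjhom_ext.
  by apply: jjhom_ext => c; rewrite /= -[LHS]/0; rewrite -(g0 c).
by apply: hU; rewrite -h'E; apply: jjhom_ext.
Qed.

(* The pullback X -> A x_B B' <-> B', with kernel x |-> (i x, 0) and section
   b |-> (s (f b), b). *)
Definition pullback_ext : split_ext B' X := SplitExt pb_projK pb_kerP.

End PullbackExt.

Section PullbackIso.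
Variables (F : fieldType) (X : jjalg F).

Lemma pullback_iso (B B' : jjalg F) (f : jjhom B' B) (E E' : split_ext B X) :
  split_iso E E' -> split_iso (pullback_ext f E) (pullback_ext f E').
Proof.
move=> [phi [/jj_isomP [psi [K1 K2]] Hi Hp Hs]].
have c1 : jjcomp (se_proj E') (jjcomp phi (fp_fst (se_proj E) f))
          = jjcomp f (fp_snd (se_proj E) f).
  by rewrite jjcompA [jjcomp (se_proj E') phi]Hp fp_comm.
have Hp' : jjcomp (se_proj E) psi = se_proj E'.
  by rewrite -Hp -[RHS]jjcomp1 -[LHS]jjcompA [jjcomp phi psi]K2.
have c2 : jjcomp (se_proj E) (jjcomp psi (fp_fst (se_proj E') f))
          = jjcomp f (fp_snd (se_proj E') f).
  by rewrite jjcompA Hp' fp_comm.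
exists (fp_pair c1); split.
- apply/jj_isomP; exists (fp_pair c2).
  split; apply: fp_ext; apply: jjhom_ext => z //=.
    exact: (congr1 (fun k : jjhom _ _ => k _) K1).
  exact: (congr1 (fun k : jjhom _ _ => k _) K2).
- apply: fp_ext; apply: jjhom_ext => z //=.
  exact: (congr1 (fun k : jjhom _ _ => k z) Hi).
- exact: jjhom_ext.
- apply: fp_ext; apply: jjhom_ext => z //=.
  exact: (congr1 (fun k : jjhom _ _ => k (f z)) Hs).
Qed.

Lemma pullback_id (B : jjalg F) (E : split_ext B X) :
  split_iso (pullback_ext (jjid B) E) E.
Proof.
have c : jjcomp (se_proj E) (jjid (se_mid E)) = jjcomp (jjid B) (se_proj E).
  by rewrite jjcomp1 jj1comp.
exists (fp_fst (se_proj E) (jjid B)); split.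
- apply/jj_isomP; exists (fp_pair c); split; last exact: jjhom_ext.
  apply: fp_ext; apply: jjhom_ext => z //=.
  exact: (sub_mem z).
- exact: jjhom_ext.
- by rewrite fp_comm; exact: jj1comp.
- exact: jjhom_ext.
Qed.

Lemma pullback_comp (B B' B'' : jjalg F) (f : jjhom B' B) (g : jjhom B'' B')
    (E : split_ext B X) :
  split_iso (pullback_ext (jjcomp f g) E) (pullback_ext g (pullback_ext f E)).
Proof.
have c1 : jjcomp (se_proj E) (fp_fst (se_proj E) (jjcomp f g))
          = jjcomp f (jjcomp g (fp_snd (se_proj E) (jjcomp f g))).
  by rewrite jjcompA fp_comm.
have c2 : jjcomp (se_proj (pullback_ext f E)) (fp_pair c1)
          = jjcomp g (fp_snd (se_proj E) (jjcomp f g)).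
  exact: jjhom_ext.
pose q := fp_fst (se_proj (pullback_ext f E)) g.
have c3 : jjcomp (se_proj E) (jjcomp (fp_fst (se_proj E) f) q)
          = jjcomp (jjcomp f g) (fp_snd (se_proj (pullback_ext f E)) g).
  by rewrite jjcompA fp_comm -!jjcompA -fp_comm.
exists (fp_pair c2); split.
- apply/jj_isomP; exists (fp_pair c3); split.
    by apply: fp_ext; apply: jjhom_ext.
  apply: fp_ext; last exact: jjhom_ext.
  apply: fp_ext; apply: jjhom_ext => z //=.
  by apply: esym; exact: (sub_mem z).
- apply: fp_ext; last exact: jjhom_ext.
  apply: fp_ext; apply: jjhom_ext => z //=.
  exact: linear0.
- exact: jjhom_ext.
- apply: fp_ext; last exact: jjhom_ext.
  by apply: fp_ext; apply: jjhom_ext.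
Qed.

Fact splext_mapP (B B' : jjalg F) (f : jjhom B' B) (c : splext B X) :
  exists E0, (fun E' => exists2 E, c E & split_iso (pullback_ext f E) E')
             = split_iso E0.
Proof.
have [E ->] := splextP c; exists (pullback_ext f E).
apply/funext => E'; apply/propext; split.
  move=> [E1 /(pullback_iso f) EE1]; exact: split_iso_trans.
by move=> H; exists E => //; exact: split_iso_refl.
Qed.

Definition splext_map (B B' : jjalg F) (f : jjhom B' B) (c : splext B X) :
  splext B' X := SplExtClass (splext_mapP f c).

Lemma splext_map_class (B B' : jjalg F) (f : jjhom B' B) (E : split_ext B X) :
  splext_map f (splext_class E) = splext_class (pullback_ext f E).
Proof.
apply: splext_inj; apply/funext => E'; apply/propext; split.
  move=> [E1 /(pullback_iso f) EE1]; exact: split_iso_trans.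
by move=> H; exists E => //; exact: split_iso_refl.
Qed.

Lemma splext_classP (B : jjalg F) (c : splext B X) : exists E, c = splext_class E.
Proof. by case: (splextP c) => E cE; exists E; apply: splext_inj. Qed.

Lemma splext_class_eq (B : jjalg F) (E E' : split_ext B X) :
  split_iso E E' -> splext_class E = splext_class E'.
Proof.
move=> H; apply: splext_inj; apply/funext => E1; apply/propext; split.
  exact/split_iso_trans/split_iso_sym.
exact: split_iso_trans.
Qed.

Fact splext_map1 (B : jjalg F) : splext_map (jjid B) = id :> (splext B X -> _).
Proof.
apply/funext => c; have [E ->] := splext_classP c.
by rewrite splext_map_class; exact/splext_class_eq/pullback_id.
Qed.

Fact splext_mapM (B B' B'' : jjalg F) (g : jjhom B'' B') (f : jjhom B' B) :
  splext_map (jjcomp f g) = splext_map g \o splext_map f.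
Proof.
apply/funext => c; have [E ->] := splext_classP c.
by rewrite /= !splext_map_class; exact/splext_class_eq/pullback_comp.
Qed.

Definition SplExt : functor (op (JJord F)) Sets :=
  @Functor (op (JJord F)) Sets (fun B => splext B X)
    (fun B B' f => splext_map f) splext_map1 (fun a b c g f => splext_mapM g f).

End PullbackIso.

Definition is_actor (F : fieldType) (X Y : JJord F) : Prop :=
  represents (SplExt X) Y.

(* Main.v *)
Require Import Defs.
From HB Require Import structures.
From mathcomp Require Import all_boot all_algebra.
From mathcomp Require Import boolp.

(** A split extension [X -> A <-> B] makes [b] act on [X] by multiplication by
    [s b]; the Jacobi identity on triples from [X], [X], [B] says that this is an
    anti-derivation, and on triples from [X], [B], [B] that [b |-> theta b] sends
    the product of [B] to the bracket.  Conversely, these two instances are what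
    the semidirect product on [X * B] needs, and [(x, b) |-> i x + s b] identifies
    it with [A]. *)

Set Implicit Arguments.
Unset Strict Implicit.
Unset Printing Implicit Defensive.

Import GRing.Theory.

Local Open Scope ring_scope.
Local Open Scope jj_scope.

(** * Elementary arithmetic in a Jacobi--Jordan algebra *)

Section JJTheory.
Variables (F : fieldType) (A : jjalg F).
Implicit Types x y z : A.

Lemma jjmulDl x y z : (x + y) ∙ z = x ∙ z + y ∙ z.
Proof. by have := jjmul_linl z 1 x y; rewrite /= !scale1r. Qed.

Lemma jjmulDr x y z : x ∙ (y + z) = x ∙ y + x ∙ z.
Proof. by rewrite !(jjmulC x) jjmulDl. Qed.

Lemma jjmul0 x : x ∙ 0 = 0.
Proof. by apply: (addrI (x ∙ 0)); rewrite -jjmulDr !addr0. Qed.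

Lemma jj0mul x : 0 ∙ x = 0.
Proof. by rewrite jjmulC jjmul0. Qed.

End JJTheory.

(** * Kernels in elementwise terms *)

Section Kernels.
Variables (F : fieldType) (X A B : jjalg F) (i : jjhom X A) (p : jjhom A B).
Hypothesis ip : is_kernel i p.

(* The two projections of the kernel pair of [i] are equalized by [i]. *)
Lemma is_kernel_inj : injective i.
Proof.
case: ip => pi0 univ x y ixy.
pose g := jjcomp i (fp_fst i i).
have pg0 c : p (g c) = 0 by exact: pi0.
have [h [_ hU]] := univ _ g pg0.
have e : fp_fst i i = fp_snd i i.
  by rewrite -(hU (fp_fst i i)) // (hU (fp_snd i i)) // -fp_comm.
have xy : fp_set i i (x, y) by [].
pose c : fibre_product i i := mk_sub (S := Subspace (fp_subspace i i)) xy.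
exact: (congr1 (fun k : jjhom (fibre_product i i) X => k c) e).
Qed.

(* Elements of the kernel are the [(a, 0)] in the pullback of [p] along [0]. *)
Lemma is_kernel_im a : p a = 0 -> exists x, i x = a.
Proof.
move=> pa0; case: ip => _ univ.
have g0 (c : fibre_product p (jjzero B B)) : p (fp_fst _ _ c) = 0.
  exact: (congr1 (fun k : jjhom _ _ => k c) (fp_comm p (jjzero B B))).
have [h [hE _]] := univ _ _ g0.
have a0 : fp_set p (jjzero B B) (a, 0) by [].
pose c : fibre_product p (jjzero B B) :=
  mk_sub (S := Subspace (fp_subspace p (jjzero B B))) a0.
by exists (h c); exact: (congr1 (fun k : jjhom _ _ => k c) hE).
Qed.

End Kernels.

(** Injectivity of [f] forces any set-theoretic inverse to be linear and multiplicative. *)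
Lemma jjhom_bij_isom (F : fieldType) (A B : jjalg F) (f : jjhom A B) (g : B -> A) :
  cancel f g -> cancel g f -> @is_isom (JJord F) A B f.
Proof.
move=> fK gK; apply/jj_isomP.
have gl : linear g.
  by move=> a u v; apply: (can_inj fK); rewrite linearP !gK.
have gM x y : g (x ∙ y) = g x ∙ g y.
  by apply: (can_inj fK); rewrite jjhomM !gK.
pose gL : {linear B -> A} := HB.pack g (GRing.isLinear.Build F B A *:%R g gl).
by exists (@JJHom F B A gL gM); split; apply: jjhom_ext.
Qed.

(** * Anti-derivations as elements of [ader X] *)

Section Ader.
Variables (F : fieldType) (X : jjalg F).

Lemma aderP (d : ader X) : antiderivation (val d).
Proof. exact: (Defs.sub_mem d). Qed.

Lemma aderD (d : ader X) x y : val d (x + y) = val d x + val d y.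
Proof. by have [dl _] := aderP d; have := dl 1 x y; rewrite !scale1r. Qed.

(** With all terms on one side, the anti-derivation law has the shape of the Jacobi sum; [sd_jacobi]
    uses it in this form. *)
Lemma aderM (d : ader X) x y : val d (x ∙ y) + x ∙ val d y + y ∙ val d x = 0.
Proof.
have [_ ->] := aderP d.
by rewrite (jjmulC x) (jjmulC y) -addrA [X in _ + X]addrC -opprD addNr.
Qed.

Lemma ader_ext (d e : ader X) : val d =1 val e -> d = e.
Proof. by move=> /funext de; apply: val_inj. Qed.

End Ader.

(** * The action attached to a split extension *)

Section Action.
Variables (F : fieldType) (B X : jjalg F) (E : split_ext B X).
Let i := se_ker E.
Let p := se_proj E.
Let s := se_sect E.

Lemma se_kerK x : p (i x) = 0.
Proof. by case: (se_kerP E). Qed.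

Lemma se_sectK b : p (s b) = b.
Proof. exact: (congr1 (fun k : jjhom _ _ => k b) (se_projK E)). Qed.

Lemma se_ker_inj : injective i.
Proof. exact: is_kernel_inj (se_kerP E). Qed.

(** The kernel is an ideal: [p] sends the product to [b ∙ 0 = 0]. *)
Lemma act_exists b x : exists y, i y = s b ∙ i x.
Proof.
by apply: (is_kernel_im (se_kerP E)); rewrite jjhomM [se_proj E (i x)]se_kerK jjmul0.
Qed.

Definition act_fun (b : B) (x : X) : X := projT1 (cid (act_exists b x)).

Lemma act_funE b x : i (act_fun b x) = s b ∙ i x.
Proof. exact: projT2 (cid (act_exists b x)). Qed.

Lemma act_antiderivation b : antiderivation (act_fun b).
Proof.
split=> [a x y|x y]; apply: se_ker_inj.
  by rewrite linearP !act_funE linearP jjmul_linr.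
rewrite linearB linearN !(jjhomM i) !act_funE jjhomM.
have /eqP := jj_jacobi (s b) (i x) (i y).
rewrite -addrA addr_eq0 => /eqP ->.
by rewrite opprD (jjmulC (i y) (s b)) (jjmulC (i y)) (jjmulC (i x)) addrC.
Qed.

Definition act_ader (b : B) : ader X :=
  mk_sub (S := Subspace (@antiderivation_subspace F X)) (act_antiderivation b).

Lemma act_ader_linear : linear act_ader.
Proof.
move=> a b c; apply: ader_ext => x; apply: se_ker_inj.
rewrite act_funE -[RHS]/(i (a *: act_fun b x + act_fun c x)).
by rewrite !linearP !act_funE jjmul_linl.
Qed.

HB.instance Definition _ :=
  GRing.isLinear.Build F B (ader X) *:%R act_ader act_ader_linear.

Lemma act_funM b c : act_fun (b ∙ c) = ader_bracket (act_fun b) (act_fun c).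
Proof.
apply/funext => x; apply: se_ker_inj.
rewrite act_funE -[RHS]/(i (- act_fun b (act_fun c x) - act_fun c (act_fun b x))).
rewrite linearB linearN !act_funE jjhomM.
have /eqP := jj_jacobi (i x) (s b) (s c).
rewrite -addrA addr_eq0 => /eqP.
by rewrite (jjmulC (i x) (s b)) (jjmulC (i x)) opprD => ->.
Qed.

(** The bracket of two actions is the action of the product [b ∙ c], hence again an anti-derivation;
    so the pair lies in the partial domain. *)
Lemma act_dom (b c : palg_of_jj B) :
  pdom b c -> @pdom _ (ADer X) (act_ader b) (act_ader c).
Proof.
by move=> _; rewrite /= /ader_dom /= -act_funM; exact: act_antiderivation.
Qed.

Lemma act_aderM (b c : palg_of_jj B) (h : pdom b c) :
  act_ader (pmul h) = @pmul _ (ADer X) _ _ (act_dom h).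
Proof. by apply: val_inj; exact: act_funM. Qed.

Definition act : palghom (palg_of_jj B) (ADer X) :=
  @PAlgHom F (palg_of_jj B) (ADer X) act_ader act_dom act_aderM.

(** Since [i] is injective, the equation [act_funE] determines the action. Actions are compared
    below by checking this equation only. *)
Lemma act_unique (f : palghom (palg_of_jj B) (ADer X)) :
  (forall b x, i (val (f b : ader X) x) = s b ∙ i x) -> act = f.
Proof.
move=> H; apply: palghom_ext => b; apply: ader_ext => x.
by apply: se_ker_inj; rewrite H act_funE.
Qed.

End Action.

(** Applying [phi] to the defining equation for [E] gives the one for [E'], so the action depends
    only on the isomorphism class. *)
Lemma act_iso (F : fieldType) (B X : jjalg F) (E E' : split_ext B X) :
  split_iso E E' -> act E' = act E.
Proof.
move=> [phi [_ Hi _ Hs]]; apply: act_unique => b x.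
by rewrite -Hi -Hs /= act_funE jjhomM.
Qed.

(** In the fibre product, the first component is the defining equation for [E] at [f b], and the
    second reads [0 = b ∙ 0]. This gives naturality. *)
Lemma act_pullback (F : fieldType) (B B' X : jjalg F) (f : jjhom B' B)
    (E : split_ext B X) :
  act (pullback_ext f E) = pacomp (act E) (palghom_of_jj f).
Proof.
apply: act_unique => b x; apply: val_inj; congr pair.
  exact: act_funE.
by rewrite /= jjmul0.
Qed.

(** * The semidirect product of an action *)

Section Semidirect.
Variables (F : fieldType) (B X : jjalg F) (f : palghom (palg_of_jj B) (ADer X)).

Let th (b : B) : X -> X := val (f b : ader X).

Lemma th_linear a b c x : th (a *: b + c) x = a *: th b x + th c x.
Proof. by rewrite /th linearP. Qed.

Lemma th_linearr b : linear (th b).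
Proof. by case: (aderP (f b)). Qed.

Lemma thD b x y : th b (x + y) = th b x + th b y.
Proof. exact: aderD. Qed.

Lemma th_anti b x y : th b (x ∙ y) + x ∙ th b y + y ∙ th b x = 0.
Proof. exact: aderM. Qed.

Lemma thM b c x : th (b ∙ c) x + th b (th c x) + th c (th b x) = 0.
Proof.
have h : @pdom _ (palg_of_jj B) b c by [].
have -> : th (b ∙ c) x = - th b (th c x) - th c (th b x).
  by rewrite /th -[b ∙ c]/(pmul h) palghomM.
by rewrite addrAC subrK addNr.
Qed.

Definition sd_mul (u v : (X * B)%type) : (X * B)%type :=
  (u.1 ∙ v.1 + th u.2 v.1 + th v.2 u.1, u.2 ∙ v.2).

Lemma sd_mulC u v : sd_mul u v = sd_mul v u.
Proof. by congr pair; rewrite ?(jjmulC v.1) ?(jjmulC v.2) // addrAC. Qed.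

Lemma sd_mul_linl v : linear (fun u => sd_mul u v).
Proof.
move=> a u w; congr pair; last exact: jjmul_linl.
rewrite /= jjmul_linl th_linear th_linearr !scalerDr.
by rewrite [LHS](AC (2*2*2) ((1*3*5)*(2*4*6))).
Qed.

Lemma sd_mul_linr u : linear (fun v => sd_mul u v).
Proof. by move=> a v w; rewrite !(sd_mulC u) sd_mul_linl. Qed.

Lemma sd_jacobi u v w :
  sd_mul u (sd_mul v w) + sd_mul v (sd_mul w u) + sd_mul w (sd_mul u v) = 0.
Proof.
case: u v w => [x a] [y b] [z c]; congr pair; last exact: jj_jacobi.
rewrite /= !jjmulDr !thD !addrA.
(* The 21 terms fall into seven vanishing triples: the Jacobi sum of [x], [y], [z], then [th_anti]
   for each of [a], [b], [c], then [thM] for each of the pairs [(b, c)], [(c, a)], [(a, b)]. *)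
rewrite [LHS](ACl ((1*8*15)*(4*10*16)*(11*17*2)*(18*3*9)
                   *(7*12*20)*(14*19*6)*(21*5*13))) /=.
by rewrite jj_jacobi !th_anti !thM !addr0.
Qed.

Definition semidirect : jjalg F :=
  @JJAlg F (X * B)%type sd_mul sd_mul_linl sd_mul_linr sd_mulC sd_jacobi.

Definition sd_ker_fun (x : X) : semidirect := (x, 0).
Definition sd_proj_fun (u : semidirect) : B := u.2.
Definition sd_sect_fun (b : B) : semidirect := (0, b).

Fact sd_ker_linear : linear sd_ker_fun.
Proof. by move=> a x y; congr pair; rewrite //= scaler0 addr0. Qed.
Fact sd_proj_linear : linear sd_proj_fun. Proof. by []. Qed.
Fact sd_sect_linear : linear sd_sect_fun.
Proof. by move=> a x y; congr pair; rewrite //= scaler0 addr0. Qed.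

HB.instance Definition _ :=
  GRing.isLinear.Build F X semidirect *:%R sd_ker_fun sd_ker_linear.
HB.instance Definition _ :=
  GRing.isLinear.Build F semidirect B *:%R sd_proj_fun sd_proj_linear.
HB.instance Definition _ :=
  GRing.isLinear.Build F B semidirect *:%R sd_sect_fun sd_sect_linear.

Lemma th0 x : th 0 x = 0.
Proof. by rewrite /th linear0. Qed.

Lemma thr0 b : th b 0 = 0.
Proof. by have := th_linearr b (-1) 0 0; rewrite scaler0 addr0 scaleN1r addNr. Qed.

Fact sd_kerM x y : sd_ker_fun (x ∙ y) = sd_ker_fun x ∙ sd_ker_fun y.
Proof. by congr pair; rewrite /= ?th0 ?addr0 ?jjmul0. Qed.

Fact sd_sectM b c : sd_sect_fun (b ∙ c) = sd_sect_fun b ∙ sd_sect_fun c.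
Proof. by congr pair; rewrite /= ?thr0 ?jjmul0 ?addr0. Qed.

Definition sd_ker : jjhom X semidirect := @JJHom F X semidirect sd_ker_fun sd_kerM.
Definition sd_proj : jjhom semidirect B :=
  @JJHom F semidirect B sd_proj_fun (fun _ _ => erefl).
Definition sd_sect : jjhom B semidirect :=
  @JJHom F B semidirect sd_sect_fun sd_sectM.

Fact sd_projK : jjcomp sd_proj sd_sect = jjid B.
Proof. exact: jjhom_ext. Qed.

Fact sd_kerP : is_kernel sd_ker sd_proj.
Proof.
split=> [//|C g g0].
(* A map killed by the projection has second component zero, so its first component is the required
   factorization through [X]. *)
have gE c : g c = sd_ker (g c).1.
  by rewrite [LHS]surjective_pairing; congr pair; exact: g0.
pose h c : X := (g c).1.
have hl : linear h by move=> a u v; rewrite /h linearP.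
have hM x y : h (x ∙ y) = h x ∙ h y.
  by rewrite /h jjhomM gE (gE y) -jjhomM.
pose hL : {linear C -> X} := HB.pack h (GRing.isLinear.Build F C X *:%R h hl).
exists (@JJHom F C X hL hM); split=> [|k kE].
  by apply: jjhom_ext => c; rewrite [RHS]gE.
by apply: jjhom_ext => c; rewrite /= /h -kE.
Qed.

Definition semidirect_ext : split_ext B X := SplitExt sd_projK sd_kerP.

Lemma act_semidirect : act semidirect_ext = f.
Proof.
apply: act_unique => b x; congr pair; rewrite /= ?jjmul0 //.
by rewrite jj0mul add0r th0 addr0.
Qed.

End Semidirect.

(** * Recovering a split extension from its action *)

Section SemidirectAct.
Variables (F : fieldType) (B X : jjalg F) (E : split_ext B X).

Definition sd_act_fun (u : semidirect (act E)) : se_mid E :=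
  se_ker E u.1 + se_sect E u.2.

Fact sd_act_linear : linear sd_act_fun.
Proof.
by move=> a u v; rewrite /sd_act_fun /= !linearP scalerDr addrACA.
Qed.

HB.instance Definition _ := GRing.isLinear.Build F (semidirect (act E)) (se_mid E)
  *:%R sd_act_fun sd_act_linear.

(** In the expanded product, the mixed terms are a section value times a kernel value, which
    [act_funE] rewrites as images of the action. *)
Fact sd_actM u v : sd_act_fun (u ∙ v) = sd_act_fun u ∙ sd_act_fun v.
Proof.
rewrite /sd_act_fun /= !linearD !act_funE !jjhomM !jjmulDl !jjmulDr.
rewrite (jjmulC (se_sect E v.2)) !addrA.
by rewrite [LHS](ACl (1*3*2*4)).
Qed.

Definition sd_act : jjhom (semidirect (act E)) (se_mid E) :=
  @JJHom F (semidirect (act E)) (se_mid E) sd_act_fun sd_actM.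

Lemma sd_act_proj u : se_proj E (sd_act u) = u.2.
Proof. by rewrite /= linearD se_kerK se_sectK add0r. Qed.

Lemma semidirect_act : split_iso (semidirect_ext (act E)) E.
Proof.
exists sd_act; split.
(* The inverse splits [a] as its kernel part [a - s (p a)] plus [s (p a)]. *)
- have ex a : exists x, se_ker E x = a - se_sect E (se_proj E a).
    by apply: (is_kernel_im (se_kerP E)); rewrite linearB se_sectK subrr.
  pose g a : semidirect (act E) := (projT1 (cid (ex a)), se_proj E a).
  have gK : cancel g sd_act.
    by move=> a; rewrite /= /sd_act_fun /= (projT2 (cid (ex a))) subrK.
  apply: (jjhom_bij_isom (g := g)) => // u.
  have e2 : (g (sd_act u)).2 = u.2 by exact: sd_act_proj.
  have := gK (sd_act u); rewrite /= /sd_act_fun e2 => /addIr /se_ker_inj e1.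
  by rewrite [LHS]surjective_pairing [RHS]surjective_pairing e2; congr pair.
- by apply: jjhom_ext => x; rewrite /= /sd_act_fun /= linear0 addr0.
- by apply: jjhom_ext => u; exact: sd_act_proj.
- by apply: jjhom_ext => b; rewrite /= /sd_act_fun /= linear0 add0r.
Qed.

End SemidirectAct.

(** * Isomorphism classes and the natural isomorphism *)

Section ClassAction.
Variables (F : fieldType) (X : jjalg F).

(** The representative is chosen arbitrarily; [class_actE] shows that the choice does not matter. *)
Definition class_act (B : jjalg F) (c : splext B X) :
  palghom (palg_of_jj B) (ADer X) := act (projT1 (cid (splext_classP c))).

Lemma class_actE (B : jjalg F) (E : split_ext B X) :
  class_act (splext_class E) = act E.
Proof.
rewrite /class_act; case: cid => E' /= e; apply: act_iso.
(* Classes are predicates: evaluating their equality at [E'] reduces [split_iso E E'] to reflexivity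
   at [E']. *)
have /(congr1 (fun P : split_ext B X -> Prop => P E')) := congr1 (@splext_set _ _ _) e.
by rewrite /= => ->; exact: split_iso_refl.
Qed.

Lemma class_actK (B : jjalg F) :
  cancel (@class_act B) (fun f => splext_class (semidirect_ext f)).
Proof.
move=> c; have [E ->] := splext_classP c; rewrite class_actE.
exact/splext_class_eq/semidirect_act.
Qed.

Lemma semidirect_classK (B : jjalg F) :
  cancel (fun f => splext_class (semidirect_ext f)) (@class_act B).
Proof. by move=> f; rewrite class_actE act_semidirect. Qed.

Lemma class_act_map (B B' : jjalg F) (f : jjhom B' B) (c : splext B X) :
  class_act (splext_map f c) = pacomp (class_act c) (palghom_of_jj f).
Proof.
have [E ->] := splext_classP c.
by rewrite splext_map_class !class_actE act_pullback.
Qed.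

Definition class_act_trans : nat_trans (SplExt X)
    (comp_functor (hom_to (ADer X)) (op_functor (forgetful F))) :=
  @NatTrans _ _ (SplExt X)
    (comp_functor (hom_to (ADer X)) (op_functor (forgetful F)))
    (fun B : jjalg F => @class_act B)
    (fun (B B' : jjalg F) (f : jjhom B' B) => funext (class_act_map f)).

Lemma class_act_iso : is_natural_iso class_act_trans.
Proof.
move=> B; exists (fun f => splext_class (semidirect_ext f)).
by split; apply/funext; [exact: class_actK | exact: semidirect_classK].
Qed.

End ClassAction.

(** * Representability when the partial algebra is total *)

Section TotalPAlg.
Variables (F : fieldType) (Y : palg F) (h : is_jj Y).

Lemma pmul_total (x y : Y) (k : pdom x y) : pmul k = pmul (is_jj_total h x y).
Proof. by rewrite (Prop_irrelevance k (is_jj_total h x y)). Qed.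

Definition jj_of_palghom (B : jjalg F) (f : palghom (palg_of_jj B) Y) :
    jjhom B (jj_of_palg h) :=
  @JJHom F B (jj_of_palg h) f
    (fun x y => etrans (palghomM f (I : @pdom _ (palg_of_jj B) x y)) (pmul_total _)).

Definition palghom_to_total (B : jjalg F) (f : jjhom B (jj_of_palg h)) :
    palghom (palg_of_jj B) Y :=
  @PAlgHom F (palg_of_jj B) Y f (fun x y _ => is_jj_total h (f x) (f y))
    (fun x y _ => jjhomM f x y).

(** For total [Y], the same linear maps underlie the homomorphisms into [Y] in both categories, so
    [rho] can be read as an isomorphism onto the functor represented by [jj_of_palg h]. *)
Lemma hom_to_total (G : functor (op (JJord F)) Sets)
    (rho : nat_trans G (comp_functor (hom_to (Y : PAlg F)) (op_functor (forgetful F)))) :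
  is_natural_iso rho -> represents G (jj_of_palg h).
Proof.
move=> rho_iso.
pose tau (B : jjalg F) (c : G B) : jjhom B (jj_of_palg h) := jj_of_palghom (rho B c).
have tauN (B B' : jjalg F) (f : jjhom B' B) (c : G B) :
    tau B' (@fmap _ _ G B B' f c) = jjcomp (tau B c) f.
  apply: jjhom_ext => b /=.
  have := congr1 (fun k => k c) (@naturality _ _ _ _ rho B B' f).
  by move=> /= ->.
exists (@NatTrans _ _ G (hom_to (jj_of_palg h : JJord F)) tau
  (fun B B' f => funext (tauN B B' f))) => B.
have [g [gK Kg]] := rho_iso B.
exists (fun f => g (palghom_to_total f)); split; apply/funext => c /=.
  rewrite -[RHS](congr1 (fun k => k c) gK) /=; congr g.
  exact: palghom_ext.
apply: jjhom_ext => b /=; rewrite /tau /=.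
by have /= -> := congr1 (fun k => k (palghom_to_total c)) Kg.
Qed.

End TotalPAlg.

Theorem theorem2p17 (F : fieldType) (X : JJord F) :
  (exists rho : nat_trans (SplExt X)
       (comp_functor (hom_to (ADer X)) (op_functor (forgetful F))),
     is_natural_iso rho)
  /\ (forall h : is_jj (ADer X),
        representable (SplExt X) /\ is_actor X (jj_of_palg h)).
Proof.
split; first by exists (class_act_trans X); exact: class_act_iso.
move=> h; have repr := hom_to_total h (class_act_iso X).
by split=> //; exists (jj_of_palg h).
Qed.
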